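(* Let $X$ be a separable, reflexive, asymptotic-$c_0$ Banach space. Then for every normalized $1$-suppression unconditional basic sequence $\bar e=(e_j)_j$ such that $\lim_{k\to\infty}\inf_{\mathbb M\in[\mathbb N]^\omega}\operatorname{diam}\big([\mathbb M]^k,d^{(k)}_{\bar e}\big)=\infty$ one has $\sup_{k\in\mathbb N}c_X\big([\mathbb N]^k,d^{(k)}_{\bar e}\big)=\infty$.
   Context: $[\mathbb M]^k$ is the set of $k$-element subsets of $\mathbb M$, $[\mathbb N]^\omega$ the set of infinite subsets of $\mathbb N$; elements $\bar m=\{m_1<\dots<m_k\}$. $(e_j)$ is $1$-suppression unconditional if $\|\sum_{j\in A}a_je_j\|\le\|\sum a_je_j\|$ for all finitely supported scalars and $A\subset\mathbb N$. $d^{(k)}_{\bar e}(\bar m,\bar n)=\|\sum_{j\in F}e_j\|$ with $F=\{j:m_j\ne n_j\}$. $c_X(M)$ is the infimum of $D\ge1$ for which there are $s>0$ and $f:M\to X$ with $s\,d(x,y)\le\|f(x)-f(y)\|\le sD\,d(x,y)$. $\{X\}_k$: norms $E$ on $\mathbb R^k$ with normalized monotone unit vector basis such that for every $\varepsilon>0$, for every closed finite-codimensional $X_1$ there is $x_1\in S_{X_1}$, ..., for every closed finite-codimensional $X_k$ there is $x_k\in S_{X_k}$ with $(x_j)$ $(1+\varepsilon)$-equivalent to $(e_j)$ (where $C$-equivalent means $\frac1A\|\sum a_ix_i\|\le\|\sum a_iy_i\|\le B\|\sum a_ix_i\|$ with $AB\le C$). $X$ is asymptotic-$c_0$ if for some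 $c$ all such bases are $c$-equivalent to the $\ell_\infty^k$ unit vector basis. *)

(* Defs.v *)
From HB Require Import structures.
From mathcomp Require Import all_boot all_order all_algebra.
From mathcomp Require Import all_classical all_reals all_analysis.
Set Implicit Arguments. Unset Strict Implicit. Unset Printing Implicit Defensive.
Import Order.TTheory GRing.Theory Num.Theory.
Import numFieldNormedType.Exports.
Local Open Scope classical_set_scope.
Local Open Scope ring_scope.

Section Defs.
Variable R : realType.

Definition cont_lin_functional (X : normedModType R) (f : X -> R) : Prop :=
  (forall (a : R) (x y : X), f (a *: x + y) = a * f x + f y) /\ continuous f.

Definition dual_norm (X : normedModType R) (f : X -> R) : R :=
  sup [set `|f x| | x in [set x : X | `|x| <= 1]].

Definition reflexive_space (X : normedModType R) : Prop :=
  forall Phi : (X -> R) -> R,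
    (forall (a : R) (f g : X -> R), cont_lin_functional f ->
        cont_lin_functional g ->
        Phi (fun x => a * f x + g x) = a * Phi f + Phi g) ->
    (exists C : R, forall f, cont_lin_functional f ->
        `|Phi f| <= C * dual_norm f) ->
    exists x : X, forall f, cont_lin_functional f -> Phi f = f x.

Definition separable (X : normedModType R) : Prop :=
  exists D : set X, countable D /\ closure D = setT.

Definition closed_fin_codim (X : normedModType R) (Y : set X) : Prop :=
  [/\ Y 0, (forall (a : R) x y, Y x -> Y y -> Y (a *: x + y)), closed Y &
      exists s : seq X, forall x : X, exists (y : X) (c : nat -> R),
        Y y /\ x = y + \sum_(i < size s) c i *: nth 0 s i].

Definition unit_vec (k : nat) (j : 'I_k) : 'rV[R]_k := \row_(i < k) (i == j)%:R.

Definition is_norm_Rk (k : nat) (E : 'rV[R]_k -> R) : Prop :=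
  [/\ forall a, 0 <= E a, forall a, E a = 0 -> a = 0,
      forall (c : R) a, E (c *: a) = `|c| * E a &
      forall a b, E (a + b) <= E a + E b].

Definition normalized_monotone (k : nat) (E : 'rV[R]_k -> R) : Prop :=
  (forall j, E (unit_vec j) = 1) /\
  (forall (m : nat) (a : 'rV[R]_k),
      E (\row_(i < k) (if (i < m)%N then a 0 i else 0)) <= E a).

(* (x_j) C-equivalent to (y_j), where nx a = ||sum a_i x_i||, ny a = ||sum a_i y_i|| *)
Definition C_equiv (k : nat) (C : R) (nx ny : 'rV[R]_k -> R) : Prop :=
  exists A B : R, [/\ 0 < A, 0 < B, A * B <= C &
    forall a, nx a / A <= ny a /\ ny a <= B * nx a].

(* the asymptotic game; xs are the vectors already chosen, m the number of
   remaining rounds *)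
Fixpoint asym_game (X : normedModType R) (k : nat) (E : 'rV[R]_k -> R)
    (eps : R) (m : nat) (xs : seq X) : Prop :=
  match m with
  | 0 => C_equiv (1 + eps)
           (fun a : 'rV[R]_k => `|\sum_(i < k) a 0 i *: nth 0 xs i|) E
  | m'.+1 => forall Y : set X, closed_fin_codim Y ->
       exists x : X, [/\ Y x, `|x| = 1 & asym_game E eps m' (rcons xs x)]
  end.

Definition in_asym_model (X : normedModType R) (k : nat) (E : 'rV[R]_k -> R) : Prop :=
  [/\ is_norm_Rk E, normalized_monotone E &
      forall eps : R, 0 < eps -> asym_game (X := X) E eps k [::]].

Definition linf_norm (k : nat) (a : 'rV[R]_k) : R := \big[Num.max/0]_(i < k) `|a 0 i|.

Definition asymptotic_c0 (X : normedModType R) : Prop :=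
  exists c : R, forall (k : nat) (E : 'rV[R]_k -> R),
    in_asym_model X E -> C_equiv c E (@linf_norm k).

Definition closed_span (Y : normedModType R) (e : nat -> Y) : set Y :=
  closure [set x | exists (n : nat) (a : nat -> R), x = \sum_(j < n) a j *: e j].

Definition basic_sequence (Y : normedModType R) (e : nat -> Y) : Prop :=
  forall x, closed_span e x ->
    (exists a : nat -> R, (fun n => \sum_(j < n) a j *: e j) @ \oo --> x) /\
    (forall a b : nat -> R,
        (fun n => \sum_(j < n) a j *: e j) @ \oo --> x ->
        (fun n => \sum_(j < n) b j *: e j) @ \oo --> x -> a = b).

Definition normalized_seq (Y : normedModType R) (e : nat -> Y) : Prop :=
  forall j, `|e j| = 1.

Definition suppression_unconditional1 (Y : normedModType R) (e : nat -> Y) : Prop :=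
  forall (n : nat) (a : nat -> R) (A : nat -> bool),
    `|\sum_(j < n | A j) a j *: e j| <= `|\sum_(j < n) a j *: e j|.

Definition ksubsets (k : nat) (M : set nat) : set (seq nat) :=
  [set m | [/\ size m = k, sorted ltn m & forall x, x \in m -> M x]].

(* d^(k)_e(m,n) = || sum_{j : m_j <> n_j} e_j ||  (positions indexed from 0) *)
Definition dk (Y : normedModType R) (e : nat -> Y) (k : nat) (m n : seq nat) : R :=
  `|\sum_(j < k | nth 0%N m j != nth 0%N n j) e j|.

Definition diam_k (Y : normedModType R) (e : nat -> Y) (k : nat) (M : set nat) : \bar R :=
  ereal_sup [set z | exists m n, [/\ ksubsets k M m, ksubsets k M n &
    z = (dk e k m n)%:E]].

Definition cX (X : normedModType R) (T : Type) (P : set T) (d : T -> T -> R) : \bar R :=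
  ereal_inf [set D%:E | D in [set D : R | 1 <= D /\
     exists s : R, 0 < s /\ exists f : T -> X, forall x y, P x -> P y ->
       s * d x y <= `|f x - f y| /\ `|f x - f y| <= s * D * d x y]].

End Defs.
Arguments separable : clear implicits.
Arguments reflexive_space : clear implicits.
Arguments asymptotic_c0 : clear implicits.
Arguments cX {R} X {T}.

(* Main.v *)
Require Import Defs.
From HB Require Import structures.
From mathcomp Require Import all_boot all_order all_algebra.
From mathcomp Require Import all_classical all_reals all_analysis.
From mathcomp Require Import ring lra.
Import Order.TTheory GRing.Theory Num.Theory.
Import numFieldNormedType.Exports.
Local Open Scope classical_set_scope.
Local Open Scope ring_scope.
Set Implicit Arguments. Unset Strict Implicit. Unset Printing Implicit Defensive.

(** Fix a nonprincipal ultrafilter [U] on [nat] and let [f] on the k-subsets be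
    D-Lipschitz up to the scale [s]. Taking iterated weak [U]-limits of [f] in the
    last coordinates (reflexivity) writes [f m] as a constant plus the sum, along
    the branch of prefixes of [m], of a weakly null tree whose nodes have norm at
    most [s * D], because two sets differing in one place are at distance at most
    1. After normalizing the nodes, the iterated [U]-limit of the norms of the
    branches is a norm on R^k. It belongs to the asymptotic structure of [X]:
    weak lower semicontinuity makes the basis monotone, and a weakly null sequence
    is eventually close to any finite-codimensional subspace, so the vector player
    can follow a generic branch. Being asymptotic-c0 then bounds the branch sums,
    so [f] is within [C * s * D] of a constant on [U]-generic k-subsets, with [C]
    independent of [k]. Every pattern of differing coordinates is realized by a
    pair of generic k-subsets, hence [dk <= 2 * C * D] everywhere and [D] grows
    with the diameters. Ultrafilter limits replace both the passage to
    subsequences and Ramsey's theorem. *)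

(** * Sublinear functionals *)

Section Sublinear.
Context {R : realType} {V : lmodType R}.
Implicit Types (p q : V -> R) (S : set (V * R)).

Definition sublinear p :=
  (forall x y, p (x + y) <= p x + p y) /\
  (forall t x, 0 <= t -> p (t *: x) = t * p x).

Lemma sublinear0 p : sublinear p -> p 0 = 0.
Proof. by case=> _ /(_ 0 0 (lexx _)); rewrite scale0r mul0r. Qed.

Lemma sublinear_oppr p x : sublinear p -> 0 <= p x + p (- x).
Proof. by move=> sp; rewrite -(sublinear0 sp) -(subrr x); apply: sp.1. Qed.

Definition cone_below p S :=
  [/\ S (0, 0), forall u v, S u -> S v -> S (u.1 + v.1, u.2 + v.2),
      forall t u, 0 <= t -> S u -> S (t *: u.1, t * u.2) &
      forall u, S u -> u.2 <= p u.1].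

(** An infimal convolution with two uses: over the ray of a vector it drives the Hahn-Banach
    argument, over a subspace at height 0 it is the distance to that subspace. *)
Definition shave p S x := inf [set p (x + u.1) - u.2 | u in S].

Lemma shave_lbound p S x : sublinear p -> cone_below p S ->
  lbound [set p (x + u.1) - u.2 | u in S] (- p (- x)).
Proof.
move=> sp [_ _ _ Sp] _ [u Su <-].
have := sp.1 (x + u.1) (- x); rewrite addrAC subrr add0r => h.
have := Sp _ Su; lra.
Qed.

Lemma shave_le p S x u : sublinear p -> cone_below p S -> S u ->
  shave p S x <= p (x + u.1) - u.2.
Proof.
move=> sp cS Su; apply: ge_inf; last by exists u.
by exists (- p (- x)); exact: shave_lbound.
Qed.

Lemma shave_ge p S x b : cone_below p S ->
  (forall u, S u -> b <= p (x + u.1) - u.2) -> b <= shave p S x.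
Proof.
move=> [S0 _ _ _] h; apply: lb_le_inf; first by exists (p (x + 0) - 0), (0, 0).
by move=> _ [u Su <-]; exact: h.
Qed.

Lemma shave_sublinear p S : sublinear p -> cone_below p S ->
  sublinear (shave p S).
Proof.
move=> sp cS; have [S0 SD SZ Sp] := cS; have [pD pZ] := sp; split=> [x y|t x t0].
  rewrite -lerBlDr; apply: shave_ge => // u Su.
  rewrite lerBlDr [leRHS]addrC -lerBlDr; apply: shave_ge => // v Sv.
  rewrite lerBlDr; apply: le_trans (shave_le _ sp cS (SD _ _ Su Sv)) _ => /=.
  have := pD (x + u.1) (y + v.1); rewrite addrACA; lra.
have [->|tn0] := eqVneq t 0.
  rewrite scale0r mul0r; apply/eqP; rewrite eq_le; apply/andP; split.
    apply: le_trans (shave_le _ sp cS S0) _.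
    by rewrite /= addr0 (sublinear0 sp) subr0.
  by apply: shave_ge => // u Su; rewrite add0r subr_ge0; exact: Sp.
have tp : 0 < t by rewrite lt_neqAle eq_sym tn0.
apply/eqP; rewrite eq_le; apply/andP; split.
  rewrite mulrC -ler_pdivrMr//; apply: shave_ge => // u Su.
  rewrite ler_pdivrMr// mulrC mulrBr -pZ// scalerDr.
  exact: (shave_le _ sp cS (SZ _ _ t0 Su)).
apply: shave_ge => // u Su.
have ti : 0 <= t^-1 by rewrite invr_ge0.
have := shave_le x sp cS (SZ _ _ ti Su) => /= h.
rewrite mulrC -ler_pdivlMr// mulrBl ![_ / t]mulrC -pZ// scalerDr.
by rewrite scalerA mulVf// scale1r.
Qed.

Lemma shave_lep p S x : sublinear p -> cone_below p S -> shave p S x <= p x.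
Proof.
move=> sp cS; have [S0 _ _ _] := cS.
by have := shave_le x sp cS S0; rewrite /= addr0 subr0.
Qed.

Definition ray_graph p v : set (V * R) :=
  [set u | exists2 t, 0 <= t & u = (t *: v, t * p v)].

Lemma ray_graph_cone p v : sublinear p -> cone_below p (ray_graph p v).
Proof.
move=> sp; split.
- by exists 0; rewrite // scale0r mul0r.
- move=> _ _ [s s0 ->] [t t0 ->]; exists (s + t); first exact: addr_ge0.
  by rewrite /= -scalerDl -mulrDl.
- move=> s _ s0 [t t0 ->]; exists (s * t); first exact: mulr_ge0.
  by rewrite /= scalerA mulrA.
- by move=> _ [t t0 ->] /=; rewrite sp.2.
Qed.

(** Supplies the bounds of chains for Zorn's lemma. The infimum is finite because
    [q x >= - q (- x) >= - p (- x)]; subadditivity uses the chain, where the smaller of two members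
    serves for both points. *)
Lemma sublinear_inf (A : set (V -> R)) p q0 : sublinear p -> A q0 ->
  (forall q, A q -> sublinear q /\ forall x, q x <= p x) ->
  total_on A (fun q q' => forall x, q' x <= q x) ->
  exists2 m, sublinear m & forall q, A q -> forall x, m x <= q x.
Proof.
move=> sp Aq0 As At; pose m x := inf [set q x | q in A].
have lb x : lbound [set q x | q in A] (- p (- x)).
  move=> _ [q Aq <-]; have [sq qp] := As _ Aq.
  have := qp (- x); have := sublinear_oppr x sq; lra.
have mle q x : A q -> m x <= q x.
  by move=> Aq; apply: ge_inf; [exists (- p (- x)); exact: lb|exists q].
have mge b x : (forall q, A q -> b <= q x) -> b <= m x.
  move=> h; apply: lb_le_inf; first by exists (q0 x), q0.
  by move=> _ [q Aq <-]; exact: h.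
exists m => [|q Aq x]; last exact: mle.
split=> [x y|t x t0].
  rewrite -lerBlDr; apply: (mge _ _) => q Aq.
  rewrite lerBlDr [leRHS]addrC -lerBlDr; apply: (mge _ _) => r Ar.
  rewrite lerBlDr; have [qr|rq] := At _ _ Aq Ar.
    apply: le_trans (mle r (x+y) Ar) _; have := (As _ Ar).1.1 x y.
    have := qr x; lra.
  apply: le_trans (mle q (x+y) Aq) _; have := (As _ Aq).1.1 x y.
  have := rq y; lra.
have [->|tn0] := eqVneq t 0.
  rewrite scale0r mul0r; apply/eqP; rewrite eq_le; apply/andP; split.
    by rewrite (le_trans (mle q0 0 Aq0))// (sublinear0 (p:=q0))//; exact: (As _ Aq0).1.
  by apply: (mge _ _) => q Aq; rewrite (sublinear0 (p:=q))//; exact: (As _ Aq).1.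
have tp : 0 < t by rewrite lt_neqAle eq_sym tn0.
apply/eqP; rewrite eq_le; apply/andP; split.
  rewrite mulrC -ler_pdivrMr//; apply: (mge _ _) => q Aq.
  by rewrite ler_pdivrMr// mulrC -(As _ Aq).1.2//; exact: mle.
apply: (mge _ _) => q Aq; rewrite (As _ Aq).1.2//.
by rewrite ler_pM2l//; exact: mle.
Qed.

(* A minimal sublinear functional equals its own shaving along every ray, which
   forces additivity. *)
Lemma hahn_banach p v : sublinear p ->
  exists f : V -> R, [/\ forall a x y, f (a *: x + y) = a * f x + f y,
    forall x, f x <= p x & f v = p v].
Proof.
move=> sp.
have cv := ray_graph_cone v sp.
(* Shaving at [v] gives [p' (- v) <= - p v], so every linear functional below [p'] takes the value
   [p v] at [v]. *)
pose p' := shave p (ray_graph p v).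
have sp' : sublinear p' by exact: shave_sublinear.
pose T := {q : V -> R | sublinear q /\ forall x, q x <= p' x}.
(* The order is reversed: a maximal element for Zorn is a minimal functional. *)
pose le (q q' : T) := `[< forall x, sval q' x <= sval q x >].
have [||||m mmin] := @Zorn T le.
- by move=> q; apply/asboolP.
- move=> q1 q2 q3 /asboolP h1 /asboolP h2; apply/asboolP => x.
  exact: le_trans (h2 x) (h1 x).
- move=> [q1 s1] [q2 s2] /asboolP h1 /asboolP h2; apply: eq_exist => /=.
  by apply/funext => x; apply/eqP; rewrite eq_le h1 h2.
- move=> A At.
  have [[r0 Ar0]|A0] := pselect (exists z, A z); last first.
    exists (exist _ p' (conj sp' (fun x => lexx _))) => s As.
    by exfalso; apply: A0; exists s.
  have [|||m sm mle] := @sublinear_inf [set sval z | z in A] p' (sval r0) sp'.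
  + by exists r0.
  + by move=> _ [q _ <-]; exact: (svalP q).
  + move=> _ _ [q Aq <-] [q' Aq' <-].
    by have [/asboolP h|/asboolP h] := At _ _ Aq Aq'; [left|right].
  + have mp x : m x <= p' x.
      by apply: le_trans (mle _ _ x) ((svalP r0).2 x); exists r0.
    exists (exist _ m (conj sm mp)) => q Aq; apply/asboolP => x /=.
    by apply: mle; exists q.
case: m mmin => q [sq qp'] mmin.
have shq w : shave q (ray_graph q w) = q.
  have sh := shave_sublinear sq (ray_graph_cone w sq).
  have shle x : shave q (ray_graph q w) x <= q x.
    exact: shave_lep sq (ray_graph_cone w sq).
  have sp'' x : shave q (ray_graph q w) x <= p' x by exact: le_trans (shle x) (qp' x).
  by have /(congr1 sval) := mmin (exist _ _ (conj sh sp'')) (asboolT shle).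
have qD x w : q (x + w) = q x + q w.
  apply/eqP; rewrite eq_le sq.1 /= -lerBrDr -[X in X <= _](congr1 (fun g => g x) (shq w)).
  apply: (shave_le (u := (w, q w)) _ sq (ray_graph_cone w sq)).
  by exists 1; rewrite // scale1r mul1r.
have qN x : q (- x) = - q x.
  by apply/eqP; rewrite -addr_eq0 -qD addNr (sublinear0 sq).
have qZ a x : q (a *: x) = a * q x.
  have [a0|a0] := leP 0 a; first exact: sq.2.
  rewrite -[a]opprK scaleNr qN sq.2 ?mulNr// oppr_ge0; exact: ltW.
exists q; split=> [a x y|x|].
- by rewrite qD qZ.
- exact: le_trans (qp' x) (shave_lep x sp cv).
- have qp x : q x <= p x by exact: le_trans (qp' x) (shave_lep x sp cv).
  apply/eqP; rewrite eq_le qp /=.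
  have := qp' (- v); rewrite qN => h.
  have : p' (- v) <= p (- v + v) - p v.
    apply: (shave_le (u := (v, p v)) _ sp cv).
    by exists 1; rewrite // scale1r mul1r.
  rewrite addNr (sublinear0 sp); lra.
Qed.
End Sublinear.

(** * Weak limits along an ultrafilter *)

Section Functionals.
Context {R : realType} {X : normedModType R}.
Implicit Types (f : X -> R) (x y : X).

Lemma clfD f x y : cont_lin_functional f -> f (x + y) = f x + f y.
Proof. by case=> lf _; have := lf 1 x y; rewrite scale1r mul1r. Qed.

Lemma clf0 f : cont_lin_functional f -> f 0 = 0.
Proof. by move=> cf; have := clfD 0 0 cf; rewrite addr0; lra. Qed.

Lemma clfZ f a x : cont_lin_functional f -> f (a *: x) = a * f x.
Proof.
by move=> cf; have := cf.1 a x 0; rewrite addr0 (clf0 cf) addr0.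
Qed.

Lemma clfN f x : cont_lin_functional f -> f (- x) = - f x.
Proof. by move=> cf; rewrite -scaleN1r (clfZ _ _ cf) mulN1r. Qed.

Lemma clfB f x y : cont_lin_functional f -> f (x - y) = f x - f y.
Proof. by move=> cf; rewrite (clfD _ _ cf) (clfN _ cf). Qed.

Lemma norm_sublinear : sublinear (fun x : X => `|x|).
Proof.
by split=> [x y|t x t0]; [exact: ler_normD|rewrite normrZ ger0_norm].
Qed.

Lemma dominated_clf f : (forall (a : R) x y, f (a *: x + y) = a * f x + f y) ->
  (forall x, f x <= `|x|) -> cont_lin_functional f.
Proof.
move=> lf fle; split=> // x; apply/cvgrPdist_le => e e0.
have fB y z : f (y - z) = f y - f z.
  by rewrite addrC -scaleN1r lf mulN1r addrC.
near=> y.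
have xy : `|x - y| <= e by near: y; exact: cvgr_dist_le.
rewrite ler_norml -fB (le_trans (fle _) xy) andbT.
by rewrite fB lerNl opprB -fB (le_trans (fle _))// distrC.
Unshelve. all: by end_near. Qed.

Lemma norming x : exists2 f, cont_lin_functional f &
  f x = `|x| /\ forall y, `|f y| <= `|y|.
Proof.
have [f [lf fle fx]] := hahn_banach x norm_sublinear.
have cf := dominated_clf lf fle.
exists f => //; split=> // y; rewrite ler_norml fle andbT lerNl -(clfN _ cf).
by rewrite -[leRHS]normrN; exact: fle.
Qed.

(** [dual_norm] is a supremum in the reals, an upper bound only once the set is known to be bounded;
    continuity at 0 provides this. *)
Lemma clf_unit_ball_bounded f : cont_lin_functional f ->
  has_ubound [set `|f x| | x in [set x : X | `|x| <= 1]].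
Proof.
move=> cf; have := cf.2 0 => /cvgrPdist_le/(_ 1 ltr01).
rewrite (clf0 cf) => /nbhs_norm0P[d /= d0 hd].
exists (2 / d) => _ [y /= y1 <-].
have : `|f ((d / 2) *: y)| <= 1.
  rewrite -normrN -[- f _]add0r; apply: hd => /=.
  rewrite normrZ gtr0_norm ?divr_gt0//.
  by apply: (@le_lt_trans _ _ (d / 2 * 1)); [rewrite ler_pM2l ?divr_gt0|lra].
rewrite (clfZ _ _ cf) normrM gtr0_norm ?divr_gt0// -ler_pdivlMl ?divr_gt0//.
by rewrite invf_div mulr1.
Qed.

Lemma dual_norm_ge0 f : cont_lin_functional f -> 0 <= dual_norm f.
Proof.
move=> cf; apply: le_trans (normr_ge0 (f 0)) _.
apply: ub_le_sup; first exact: clf_unit_ball_bounded.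
by exists 0 => //=; rewrite normr0.
Qed.

Lemma clf_dual_norm f x : cont_lin_functional f -> `|f x| <= dual_norm f * `|x|.
Proof.
move=> cf.
have [->|x0] := eqVneq x 0; first by rewrite (clf0 cf) !normr0 mulr0.
have nx : 0 < `|x| by rewrite normr_gt0.
rewrite -ler_pdivrMr// mulrC -[_^-1]gtr0_norm ?invr_gt0// -normrM -(clfZ _ _ cf).
apply: ub_le_sup; [exact: clf_unit_ball_bounded|]; exists (`|x|^-1 *: x) => //=.
by rewrite normrZ normfV normr_id mulVf// gt_eqF.
Qed.
End Functionals.

Lemma cvg_le {R : realType} {T : Type} (F : set_system T) {FF : ProperFilter F}
  (f g : T -> R) a b : f @ F --> a -> g @ F --> b ->
  (\forall m \near F, f m <= g m) -> a <= b.
Proof.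
move=> fa gb fg; rewrite -subr_ge0; apply: (cvgr_to_ge (cvgB gb fa)).
by apply: filterS fg => m /=; rewrite subr_ge0.
Qed.

Section Ultra.
Context {R : realType} {T : Type} (U : set_system T) {UU : UltraFilter U}.

(** Compactness of the segment gives a cluster point, and an ultrafilter converges to its cluster
    points. *)
Lemma ultra_cvg (h : T -> R) K : (forall m, `|h m| <= K) -> cvg (h @ U).
Proof.
move=> hK.
have FA : (h @ U) [set` `[- K, K]].
  by apply: (@filterE _ U) => m; rewrite /= in_itv /= -ler_norml.
have [p [_ clp]] := @segment_compact R (- K) K (h @ U) _ FA.
apply/cvg_ex; exists p => N Np.
have [//|h1] := in_ultra_setVsetC (h @^-1` N) UU.
have [y [hy Ny]] := clp (~` N) N h1 Np; exact: False_ind (hy Ny).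
Qed.

Context {X : completeNormedModType R}.
Implicit Types u : T -> X.

Definition wcvg u (x : X) :=
  forall f : X -> R, cont_lin_functional f -> f (u m) @[m --> U] --> f x.

(** Sending [f] to the limit of [f (u m)] is a bounded functional on the dual; reflexivity
    represents it by a point. *)
Lemma reflexive_wcvg u K : reflexive_space R X -> (forall m, `|u m| <= K) ->
  exists x, wcvg u x.
Proof.
move=> refl uK.
have cu (f : X -> R) : cont_lin_functional f -> cvg (f (u m) @[m --> U]).
  move=> cf; apply: (@ultra_cvg _ (dual_norm f * K)) => m.
  apply: le_trans (clf_dual_norm _ cf) _; rewrite ler_wpM2l//.
  exact: dual_norm_ge0.
have [|//|x hx] := refl (fun f => lim (f (u m) @[m --> U])).
- move=> a f g cf cg; apply: cvg_lim => //.
  by apply: cvgD; [apply: cvgM; [exact: cvg_cst|]|]; apply: cu.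
- exists K => f cf.
  apply: (cvgr_to_le (cvg_norm (cu f cf))); apply: filterE => m.
  apply: le_trans (clf_dual_norm _ cf) _; rewrite mulrC ler_wpM2r//.
  exact: dual_norm_ge0.
exists x => f cf; rewrite -hx//; exact: cu.
Qed.

(** Weak lower semicontinuity of the norm, by testing on a functional that norms [x]. *)
Lemma wcvg_norm_le u x L : wcvg u x -> (\forall m \near U, `|u m| <= L) -> `|x| <= L.
Proof.
move=> ux uL; have [f cf [fx fle]] := norming x.
rewrite -fx; apply: (cvgr_to_le (ux f cf)).
by apply: filterS uL => m; apply: le_trans; apply: le_trans (fle _); exact: ler_norm.
Qed.

Lemma wcvgB u v x y : wcvg u x -> wcvg v y -> wcvg (fun m => u m - v m) (x - y).
Proof.
move=> ux vy f cf; rewrite (clfB _ _ cf).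
under eq_fun do rewrite (clfB _ _ cf).
by apply: cvgB; [exact: ux|exact: vy].
Qed.

Lemma wcvg_cst x : wcvg (fun=> x) x.
Proof. by move=> f _; exact: cvg_cst. Qed.

Lemma near_wcvg u v x : (\forall m \near U, u m = v m) -> wcvg u x -> wcvg v x.
Proof.
move=> uv ux f cf; apply: cvg_trans (ux f cf); apply: near_eq_cvg.
by apply: filterS uv => m /= ->.
Qed.
End Ultra.

(** * Weakly null sequences and finite codimension *)

Section FiniteCodim.
Context {R : realType} {V : lmodType R}.
Implicit Types (p : V -> R) (Y : set V) (s : seq V).

Definition seminorm p := sublinear p /\ forall x, p (- x) = p x.

Lemma seminorm_ge0 p x : seminorm p -> 0 <= p x.
Proof. by case=> sp pN; have h := sublinear_oppr x sp; rewrite pN in h; lra. Qed.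

Lemma seminormZ p t x : seminorm p -> p (t *: x) = `|t| * p x.
Proof.
case=> sp pN; have [t0|t0] := leP 0 t; first by rewrite sp.2 ?ger0_norm.
by rewrite -pN -scaleNr sp.2 ?ltr0_norm // oppr_ge0 ltW.
Qed.

Definition linear_set Y := Y 0 /\ forall (a : R) x y, Y x -> Y y -> Y (a *: x + y).

Definition quotient_seminorm p Y := shave p (Y `*` [set 0]).

Lemma linear_set_cone p Y : seminorm p -> linear_set Y ->
  cone_below p (Y `*` [set 0]).
Proof.
move=> sp [Y0 Yl]; split=> //=.
- move=> [u a] [v b] [/= Yu ->] [/= Yv ->]; split=> /=; last by rewrite addr0.
  by rewrite -[u]scale1r; exact: Yl.
- move=> t [u a] t0 [/= Yu ->]; split=> /=; last by rewrite mulr0.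
  by rewrite -[_ *: _]addr0; exact: Yl.
- by move=> [u a] [/= _ ->]; exact: seminorm_ge0.
Qed.

Lemma quotient_seminorm_le p Y x y : seminorm p -> linear_set Y -> Y y ->
  quotient_seminorm p Y x <= p (x - y).
Proof.
move=> sp lY Yy.
have Yy' : (Y `*` [set (0 : R)]) (- y, 0).
  by split=> //=; rewrite -scaleN1r -[_ *: _]addr0; apply: lY.2 => //; exact: lY.1.
by have := shave_le x sp.1 (linear_set_cone sp lY) Yy'; rewrite /= subr0.
Qed.

Lemma quotient_seminorm_lt p Y x b : seminorm p -> linear_set Y ->
  quotient_seminorm p Y x < b -> exists2 y, Y y & p (x - y) < b.
Proof.
move=> sp lY xb; apply: contrapT => h; move: xb; apply/negP; rewrite -leNgt.
apply: shave_ge (linear_set_cone sp lY) _ => -[u a] [/= Yu ->]; rewrite subr0.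
rewrite leNgt; apply/negP => ub; apply: h; exists (- u); last by rewrite opprK.
by rewrite -scaleN1r -[_ *: _]addr0; apply: lY.2 => //; exact: lY.1.
Qed.

Lemma quotient_seminorm_seminorm p Y : seminorm p -> linear_set Y ->
  seminorm (quotient_seminorm p Y).
Proof.
move=> sp lY; split; first exact: (shave_sublinear sp.1 (linear_set_cone sp lY)).
suff h x : quotient_seminorm p Y (- x) <= quotient_seminorm p Y x.
  by move=> x; apply/eqP; rewrite eq_le h -{1}[x]opprK h.
rewrite leNgt; apply/negP => /(quotient_seminorm_lt sp lY)[y Yy].
have Yy' : Y (- y).
  by rewrite -scaleN1r -[_ *: _]addr0; apply: lY.2 => //; exact: lY.1.
rewrite ltNge; have := quotient_seminorm_le (- x) sp lY Yy'.
by rewrite -opprB sp.2 opprK addrC => ->.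
Qed.

(** The list [s] spans modulo the kernel of [p]. Vectors are peeled off one at a time while the
    seminorm changes, so no quotient space is built. *)
Fixpoint spans_mod p s x : Prop :=
  if s is w :: s' then exists c : R, spans_mod p s' (x - c *: w) else p x = 0.

Lemma spans_mod_sum p s x (c : nat -> R) : p x = 0 ->
  spans_mod p s (x + \sum_(i < size s) c i *: nth 0 s i).
Proof.
elim: s x c => [|w s IH] x c px /=; first by rewrite big_ord0 addr0.
exists (c 0%N); rewrite big_ord_recl /= addrCA [X in X - _]addrC addrK.
exact: (IH x (fun i => c i.+1)).
Qed.

Definition line (w : V) : set V := range (fun t : R => t *: w).

Lemma line_linear w : linear_set (line w).
Proof.
split; first by exists 0 => //; rewrite scale0r.
by move=> a _ _ [s _ <-] [t _ <-]; exists (a * s + t) => //; rewrite scalerDl scalerA.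
Qed.

Lemma spans_mod_line p w s x c : seminorm p -> spans_mod p s (x - c *: w) ->
  spans_mod (quotient_seminorm p (line w)) s x.
Proof.
move=> sp; have sq := quotient_seminorm_seminorm sp (line_linear w).
elim: s x => [|v s IH] x /=.
  move=> h; apply/eqP; rewrite eq_le (seminorm_ge0 _ sq) andbT -h.
  by apply: quotient_seminorm_le => //; [exact: line_linear|exists c].
by case=> d h; exists d; apply: IH; rewrite addrAC.
Qed.

Context (U : set_system nat) {UU : UltraFilter U}.
Hypothesis Uoo : \oo `<=` U.

(** Compactness in finite dimension, for a seminorm. By induction there is convergence modulo the
    line of [w]; it is then corrected along [w] by coefficients that converge in turn. *)
Lemma seminorm_ultra_cvg p s (u : nat -> V) K : seminorm p ->
  (forall x, spans_mod p s x) -> (forall m, p (u m) <= K) ->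
  exists v, p (u m - v) @[m --> U] --> (0 : R).
Proof.
elim: s p => [|w s IH] p sp sm pK.
  exists 0; rewrite (_ : (fun m => _) = cst 0); first exact: cvg_cst.
  by apply/funext => m; exact: sm.
pose q := quotient_seminorm p (line w).
have lw := line_linear w.
have sq : seminorm q by exact: quotient_seminorm_seminorm.
have qp x : q x <= p x.
  by rewrite -[leRHS](congr1 p (subr0 x)); apply: quotient_seminorm_le => //; exact: lw.1.
have [x||v qv] := IH q sq.
- by have [c] := sm x; exact: spans_mod_line.
- by move=> m; exact: le_trans (qp _) (pK m).
have pD x y : p (x + y) <= p x + p y by exact: sp.1.1.
(* The slack [m.+1%:R^-1] replaces an exact minimizer and vanishes along [U], which contains the
   tails. *)
have ex m : exists t : R, p (u m - v - t *: w) < q (u m - v) + m.+1%:R^-1.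
  have h : q (u m - v) < q (u m - v) + m.+1%:R^-1 by rewrite ltrDl invr_gt0.
  by have [_ [t _ <-] ?] := quotient_seminorm_lt sp lw h; exists t.
have [t ht] := choice ex.
have qt0 : q (u m - v) + m.+1%:R^-1 @[m --> U] --> (0 : R).
  rewrite -[0]addr0; apply: cvgD => //; apply: cvg_trans (@cvg_harmonic R).
  exact: cvg_app.
(* If [p w] is 0, the coefficients are uncontrolled but [p] does not see multiples of [w]; otherwise
   division by [p w] bounds them. *)
have [pw|pw] := eqVneq (p w) 0.
  exists v; apply: squeeze_cvgr (cvg_cst 0) qt0.
  apply: filterE => m; rewrite seminorm_ge0//=; apply: le_trans (ltW (ht m)).
  have := pD (u m - v - t m *: w) (t m *: w); rewrite subrK seminormZ// pw mulr0 addr0.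
  by [].
have pw0 : 0 < p w by rewrite lt_neqAle eq_sym pw seminorm_ge0.
have uvK m : p (u m - v) <= K + p v.
  by apply: le_trans (pD _ _) _; rewrite sp.2 lerD2r.
have tK m : `|t m| <= (1 + (K + p v) + (K + p v)) / p w.
  rewrite ler_pdivlMr// -seminormZ//.
  rewrite -[t m *: w](subKr (u m - v)); apply: le_trans (pD _ _) _.
  rewrite sp.2 addrC lerD ?uvK//; apply: le_trans (ltW (ht m)) _.
  rewrite addrC lerD//; last exact: le_trans (qp _) (uvK m).
  by rewrite invf_le1// ler1n.
have ht0 : t @ U --> lim (t @ U) by exact: ultra_cvg tK.
set t0 := lim (t @ U) in ht0.
exists (v + t0 *: w).
have tw0 : `|t m - t0| * p w @[m --> U] --> (0 : R).
  rewrite -(mul0r (p w)); apply: cvgM; last exact: cvg_cst.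
  rewrite -(normr0 R); apply: cvg_norm.
  by rewrite -(subrr t0); apply: cvgB => //; exact: cvg_cst.
have sum0 : (q (u m - v) + m.+1%:R^-1) + `|t m - t0| * p w @[m --> U] --> (0 : R).
  by rewrite -[0]addr0; exact: cvgD qt0 tw0.
apply: squeeze_cvgr (cvg_cst 0) sum0.
apply: filterE => m; rewrite seminorm_ge0//=.
have := pD (u m - v - t m *: w) ((t m - t0) *: w).
rewrite seminormZ// scalerBl addrA subrK -addrA -opprD => /le_trans; apply.
by rewrite lerD2r ltW.
Qed.
End FiniteCodim.

Section WeaklyNull.
Context {R : realType} {X : completeNormedModType R}.
Context (U : set_system nat) {UU : UltraFilter U}.
Hypothesis Uoo : \oo `<=` U.

(** Modulo [Y] the space is finite-dimensional, so [u m] tends to some [v] for the distance to [Y].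
    A functional norming [v] for this distance is continuous and tends to 0 on [u m], hence [v] is
    at distance 0. *)
Lemma wnull_near_fin_codim (u : nat -> X) (Y : set X) K d :
  wcvg U u 0 -> (forall m, `|u m| <= K) -> closed_fin_codim Y -> 0 < d ->
  \forall m \near U, exists2 y, Y y & `|u m - y| < d.
Proof.
move=> u0 uK [Y0 Yl _ [s hs]] d0.
have sn : seminorm (fun x : X => `|x|) by split; [exact: norm_sublinear|exact: normrN].
have lY : linear_set Y by [].
pose p := quotient_seminorm (fun x : X => `|x|) Y.
have sp : seminorm p by exact: quotient_seminorm_seminorm.
have ple x : p x <= `|x|.
  by rewrite -[leRHS](congr1 _ (subr0 x)); exact: quotient_seminorm_le.
have [|m|v pv] := @seminorm_ultra_cvg _ _ U UU Uoo p s u K sp.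
- move=> x; have [y [c [Yy ->]]] := hs x; apply: spans_mod_sum.
  apply/eqP; rewrite eq_le (seminorm_ge0 _ sp) andbT.
  by apply: le_trans (quotient_seminorm_le _ sn lY Yy) _; rewrite subrr normr0.
- exact: le_trans (ple _) (uK m).
have [f [lf fp fv]] := hahn_banach v sp.1.
have cf : cont_lin_functional f.
  by apply: dominated_clf => // x; exact: le_trans (fp x) (ple x).
have fv0 : p v <= 0.
  have h : f (u m) + p (u m - v) @[m --> U] --> (0 : R).
    by rewrite -[0]addr0 -{1}(clf0 cf); exact: cvgD (u0 f cf) pv.
  rewrite -fv; apply: (cvgr_to_ge h); apply: filterE => m.
  have := fp (v - u m); rewrite -[X in _ <= X]sp.2 opprB (clfB _ _ cf) /=; lra.
near=> m; apply: (quotient_seminorm_lt sn lY); rewrite -/(p _).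
have := sp.1.1 (u m - v) v; rewrite subrK => h.
have : p (u m - v) < d by near: m; exact: cvgr_lt pv _ d0.
lra.
Unshelve. all: by end_near. Qed.

Lemma wnull_near_sphere (u : nat -> X) (Y : set X) K d :
  wcvg U u 0 -> (forall m, `|u m| <= K) -> (\forall m \near U, `|u m| = 1) ->
  closed_fin_codim Y -> 0 < d ->
  \forall m \near U, exists x, [/\ Y x, `|x| = 1 & `|x - u m| <= d].
Proof.
(* One [d / 2] pays for approximating [u m], the other for normalizing; [2^-1] keeps the approximant
   away from 0. *)
move=> u0 uK u1 cY d0; pose e := Num.min (d / 2) (2^-1).
have e0 : 0 < e by rewrite lt_min divr_gt0//= invr_gt0.
have ed : e <= d / 2 by rewrite ge_min lexx.
have e2 : e <= 2^-1 by rewrite ge_min lexx orbT.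
have := wnull_near_fin_codim u0 uK cY e0; apply: filterS2 u1 => m um [y Yy uy].
have yd : `| `|y| - 1| < e.
  by rewrite -um; apply: le_lt_trans (ler_dist_dist _ _) _; rewrite distrC.
have y0 : 0 < `|y| by move: yd; rewrite ltr_norml; lra.
exists (`|y|^-1 *: y); split.
- by case: cY => Y0 Yl _ _; rewrite -[_ *: _]addr0; exact: Yl.
- by rewrite normrZ normfV normr_id mulVf// gt_eqF.
have -> : `|y|^-1 *: y - u m = (`|y|^-1 - 1) *: y + (y - u m).
  by rewrite scalerBl scale1r addrA subrK.
apply: le_trans (ler_normD _ _) _; rewrite normrZ -{2}[`|y|]normr_id -normrM mulrBl.
rewrite mulVf ?gt_eqF// mul1r distrC [X in _ + X]distrC.
have := ltW yd; have := ltW uy; lra.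
Qed.
End WeaklyNull.

(** * Seminorms on R^k *)

Section SupNorm.
Context {R : realType} {k : nat}.
Implicit Types (a b : 'rV[R]_k) (p : 'rV[R]_k -> R).

Lemma linf_normE a : linf_norm a = `|a|.
Proof.
rewrite [RHS]/Num.norm /= mx_normrE; apply/eqP; rewrite eq_le; apply/andP; split.
  apply/bigmax_leP; split=> [|i _]; first by apply/bigmax_geP; left.
  exact: (le_bigmax _ (fun ij => `|a ij.1 ij.2|) (0, i)).
apply/bigmax_leP; split=> [|[j i] _ /=]; first by apply/bigmax_geP; left.
by rewrite ord1; exact: (le_bigmax _ (fun i => `|a 0 i|)).
Qed.

Lemma coord_le_norm a i : `|a 0 i| <= `|a|.
Proof. by rewrite -linf_normE; exact: (le_bigmax _ (fun i => `|a 0 i|)). Qed.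

Lemma row_norm_le a c : 0 <= c -> (forall i, `|a 0 i| <= c) -> `|a| <= c.
Proof. by move=> c0 h; rewrite -linf_normE; apply: bigmax_le. Qed.

(** The constant [k] fits sums of [k] vectors of norm at most 1. Being uniform, it makes the class
    equi-Lipschitz and closed under pointwise limits. *)
Definition dominated_seminorm p := seminorm p /\ forall a, p a <= k%:R * `|a|.

Lemma dominated_dist p a b : dominated_seminorm p ->
  `|p a - p b| <= k%:R * `|a - b|.
Proof.
move=> [[sp pN] pk].
have h a' b' : p a' - p b' <= k%:R * `|a' - b'|.
  apply: le_trans (pk _); rewrite lerBlDr.
  by have := sp.1 (a' - b') b'; rewrite subrK.
by rewrite ler_norml lerNl opprB h distrC h.
Qed.

Context {T : Type} (F : set_system T) {FF : ProperFilter F}.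
Variables (N : T -> 'rV[R]_k -> R) (N0 : 'rV[R]_k -> R).
Hypothesis NF : forall m, dominated_seminorm (N m).
Hypothesis NN0 : forall a, N m a @[m --> F] --> N0 a.

Lemma dominated_seminorm_lim : dominated_seminorm N0.
Proof.
split; first split; first split.
- move=> a b; apply: (cvg_le (@NN0 (a + b)) (cvgD (@NN0 a) (@NN0 b))).
  by apply: filterE => m; exact: (NF m).1.1.1.
- move=> t a t0.
  have h : N m (t *: a) @[m --> F] --> t * N0 a.
    rewrite (_ : (fun m => _) = (fun m => t * N m a)).
      by apply: cvgM; [exact: cvg_cst|exact: NN0].
    by apply/funext => m; exact: (NF m).1.1.2.
  by apply: (cvg_unique _ (@NN0 _) h); exact: Rhausdorff.
- move=> a.
  have h : N m (- a) @[m --> F] --> N0 a.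
    rewrite (_ : (fun m => _) = (fun m => N m a)); first exact: NN0.
    by apply/funext => m; exact: (NF m).1.2.
  by apply: (cvg_unique _ (@NN0 _) h); exact: Rhausdorff.
- move=> a; apply: (cvgr_to_le (@NN0 a)); apply: filterE => m.
  exact: (NF m).2.
Qed.

(** Equi-Lipschitz seminorms that converge pointwise converge uniformly on the compact unit cube;
    homogeneity does the rest. *)
Lemma near_uniform d : 0 < d -> \forall m \near F, forall a, `|N m a - N0 a| <= d * `|a|.
Proof.
move=> d0; pose K := [set a : 'rV[R]_k | forall i, a ord0 i \in `[-1, 1]%R].
have cK : compact K.
  by apply: (@rV_compact R k (fun=> [set` `[-1, 1]%R])) => i; exact: segment_compact.
have N0F := dominated_seminorm_lim.
have k0 : 0 < (k.+1)%:R :> R by rewrite ltr0n.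
have kk : k%:R <= k.+1%:R :> R by rewrite ler_nat.
have cov : \forall m \near F, K `<=` (fun a => `|N m a - N0 a| <= d).
  apply: (iffLR (compact_near_coveringP K) cK) => a Ka.
  (* Three errors of [d / 3]; [k.+1] keeps the divisor positive when [k] is 0. *)
  have e0 : 0 < d / 3 / k.+1%:R by rewrite !divr_gt0.
  near=> b m => /=.
  have ab : `|a - b| <= d / 3 / k.+1%:R.
    by near: b; exact: cvgr_dist_le.
  have kab : k%:R * `|a - b| <= d / 3.
    by apply: le_trans (ler_wpM2r _ kk) _; rewrite // mulrC -ler_pdivlMr.
  have h1 := le_trans (dominated_dist a b (NF m)) kab.
  have h2 := le_trans (dominated_dist a b N0F) kab.
  have h3 : `|N0 a - N m a| <= d / 3.
    by near: m; apply: cvgr_dist_le; [exact: NN0|rewrite divr_gt0].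
  move: h1 h2 h3; rewrite !ler_norml; lra.
apply: filterS cov => m h a.
have [->|a0] := eqVneq a 0.
  by rewrite (sublinear0 (NF m).1.1) (sublinear0 N0F.1.1) subrr !normr0 mulr0.
have na : 0 < `|a| by rewrite normr_gt0.
have : `|N m (`|a|^-1 *: a) - N0 (`|a|^-1 *: a)| <= d.
  apply: h => i; rewrite mxE in_itv /= -ler_norml normrM normfV normr_id.
  by rewrite mulrC ler_pdivrMr// mul1r; exact: coord_le_norm.
rewrite (seminormZ _ _ (NF m).1) (seminormZ _ _ N0F.1) normfV normr_id.
rewrite -mulrBr normrM normfV normr_id.
by rewrite mulrC ler_pdivrMr.
Unshelve. all: by end_near. Qed.
End SupNorm.

Section Truncation.
Context {R : realType} {k : nat}.
Implicit Types (a : 'rV[R]_k).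

(** Spelled as in [normalized_monotone], so that monotonicity of the tree norm applies verbatim. *)
Definition trunc m a : 'rV[R]_k := \row_(i < k) (if (i < m)%N then a 0 i else 0).

Lemma trunc_ge m a : (k <= m)%N -> trunc m a = a.
Proof.
move=> km; apply/rowP => i; rewrite mxE.
by rewrite (leq_trans (ltn_ord i) km).
Qed.

Lemma truncS (j : 'I_k) a : trunc j.+1 a - trunc j a = a 0 j *: unit_vec R j.
Proof.
apply/rowP => i; rewrite !mxE ltnS leq_eqVlt (inj_eq val_inj).
have [->|ij] := eqVneq i j; first by rewrite ltnn subr0 mulr1.
by rewrite mulr0 subrr.
Qed.
End Truncation.

(** * The norm of a weakly null tree *)

Lemma near_sorted_rcons (U : set_system nat) {FU : Filter U} s : \oo `<=` U ->
  sorted ltn s -> \forall m \near U, sorted ltn (rcons s m).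
Proof.
move=> Uoo ss.
have h := Uoo _ (nbhs_infty_gt (\max_(x <- s) x)).
apply: filterS h => m /= mx; rewrite sorted_pairwise; last exact: ltn_trans.
rewrite pairwise_rcons -sorted_pairwise ?ss ?andbT; last exact: ltn_trans.
apply/allP => x xs; apply: leq_ltn_trans mx.
exact: (leq_bigmax_seq x).
Qed.

(** * Iterated ultrafilter quantifiers over branches *)

Section GenericBranches.
Context (U : set_system nat) {UU : UltraFilter U}.
Implicit Types (P Q : seq nat -> Prop) (s : seq nat).

(** Membership in the [r]-fold iterated product of [U] above the prefix [s], the first new entry
    being quantified outermost. *)
Fixpoint generic r s P : Prop :=
  if r is r'.+1 then \forall m \near U, generic r' (rcons s m) P else P s.

Lemma generic_mono r s P Q :
  (forall w, size w = r -> P (s ++ w) -> Q (s ++ w)) ->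
  generic r s P -> generic r s Q.
Proof.
elim: r s => [|r IH] s PQ /=; first by have := PQ [::] erefl; rewrite cats0.
apply: filterS => m; apply: IH => w wr; rewrite cat_rcons; apply: PQ.
by rewrite /= wr.
Qed.

Lemma generic_and r s P Q : generic r s P -> generic r s Q ->
  generic r s (fun s' => P s' /\ Q s').
Proof.
elim: r s => [|r IH] s /=; first by split.
by apply: filterS2 => m; exact: IH.
Qed.

Lemma generic_steps r s P : (forall s', \forall m \near U, P (rcons s' m)) ->
  generic r s (fun s' => forall i, (size s <= i < size s + r)%N -> P (take i.+1 s')).
Proof.
move=> hP; elim: r s => [|r IH] s /=.
  by move=> i; rewrite addn0 ltnNge andbN.
apply: filterS (hP s) => m Pm; apply: generic_mono (IH _) => w wr h i.
rewrite leq_eqVlt => /andP[/orP[/eqP <- _|si ir]].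
  by rewrite -(size_rcons s m) take_size_cat.
by apply: h; rewrite size_rcons si addSnnS.
Qed.

Lemma generic_sorted r s : \oo `<=` U -> sorted ltn s -> generic r s (sorted ltn).
Proof.
move=> Uoo; elim: r s => [|r IH] s //= ss.
by apply: filterS (near_sorted_rcons Uoo ss) => m; exact: IH.
Qed.

(** Both branches grow together. At each level the two sets of good entries lie in [U]: a common
    element gives equality, and a larger element of the second set, which exists since [U] contains
    the tails, gives difference. *)
Lemma generic_pair r s s' P Q (F : nat -> bool) : \oo `<=` U ->
  generic r s P -> generic r s' Q ->
  exists w w', [/\ size w = r, size w' = r, P (s ++ w), Q (s' ++ w') &
    forall i, (i < r)%N -> (nth 0 w i != nth 0 w' i)%N = F i].
Proof.
move=> Uoo; elim: r s s' F => [|r IH] s s' F /= hP hQ.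
  by exists [::], [::]; rewrite !cats0.
have [m [Pm Qm]] := filter_ex (filterI hP hQ).
have [m' Qm' mF] : exists2 m', generic r (rcons s' m') Q & (m != m')%N = F 0%N.
  case F0 : (F 0%N); last by exists m; rewrite ?eqxx.
  have := filter_ex (filterI hQ (Uoo _ (nbhs_infty_gt m))) => -[m' [Qm' mm']].
  by exists m' => //; rewrite ltn_eqF.
have [w [w' [wr wr' Pw Qw h]]] := IH _ _ (fun i => F i.+1) Pm Qm'.
exists (m :: w), (m' :: w'); rewrite -!cat_rcons /= wr wr'; split=> // -[|i] //= ir.
exact: h.
Qed.
End GenericBranches.

(** * The limit norm of a normalized weakly null tree and the asymptotic game *)

Section TreeNorm.
Context {R : realType} {X : completeNormedModType R}.
Context (U : set_system nat) {UU : UltraFilter U}.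
Hypothesis Uoo : \oo `<=` U.
Variables (k : nat) (t : seq nat -> X).
Hypothesis t_le1 : forall s, `|t s| <= 1.
Hypothesis t_norm1 : forall s, \forall m \near U, `|t (rcons s m)| = 1.
Hypothesis t_null : forall s, wcvg U (fun m => t (rcons s m)) 0.
Implicit Types (a b : 'rV[R]_k) (s : seq nat).

(** When [s] is shorter than [k], [take] returns [s] itself at the missing levels; partial branches
    are therefore used with coefficients that vanish from [size s] on. *)
Definition branch_sum s a : X := \sum_(i < k) a 0 i *: t (take i.+1 s).

Fixpoint tree_norm r s a : R :=
  if r is r'.+1 then lim (tree_norm r' (rcons s m) a @[m --> U])
  else `|branch_sum s a|.

Lemma dominated_branch_norm s : dominated_seminorm (fun a => `|branch_sum s a|).
Proof.
split; first split; first split.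
- move=> a b; rewrite (_ : branch_sum s (a + b) = branch_sum s a + branch_sum s b).
    exact: ler_normD.
  by rewrite -big_split /=; apply: eq_bigr => i _; rewrite mxE scalerDl.
- move=> c a c0; rewrite -[c in RHS]ger0_norm// -normrZ scaler_sumr; congr `|_|.
  by apply: eq_bigr => i _; rewrite mxE scalerA.
- move=> a; rewrite -normrN -sumrN; congr `|_|.
  by apply: eq_bigr => i _; rewrite mxE scaleNr opprK.
- move=> a; apply: le_trans (ler_norm_sum _ _ _) _.
  have -> : k%:R * `|a| = \sum_(i < k) `|a| by rewrite sumr_const card_ord mulr_natl.
  apply: ler_sum => i _.
  rewrite normrZ -[leRHS]mulr1; apply: ler_pM => //.
  exact: coord_le_norm.
Qed.

Lemma dominated_tree_norm r s : dominated_seminorm (tree_norm r s).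
Proof.
elim: r s => [|r IH] s; first exact: dominated_branch_norm.
apply: (dominated_seminorm_lim (F := U) (N := fun m => tree_norm r (rcons s m))) => //= a.
apply: (@ultra_cvg _ _ U UU _ (k%:R * `|a|)) => m.
by rewrite ger0_norm; [exact: (IH _).2|exact: seminorm_ge0 (IH _).1].
Qed.

Lemma tree_norm_cvg r s a :
  tree_norm r (rcons s m) a @[m --> U] --> tree_norm r.+1 s a.
Proof.
apply: (@ultra_cvg _ _ U UU _ (k%:R * `|a|)) => m.
have h := dominated_tree_norm r (rcons s m).
by rewrite ger0_norm; [exact: h.2|exact: seminorm_ge0 h.1].
Qed.

Lemma near_tree_norm r s d : 0 < d -> \forall m \near U,
  forall a, `|tree_norm r (rcons s m) a - tree_norm r.+1 s a| <= d * `|a|.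
Proof.
apply: near_uniform => [m|a]; first exact: dominated_tree_norm.
exact: tree_norm_cvg.
Qed.

Lemma branch_sum_rcons s m a : (forall i : 'I_k, (size s <= i)%N -> a 0 i = 0) ->
  branch_sum (rcons s m) a = branch_sum s a.
Proof.
move=> h; apply: eq_bigr => i _; have [si|si] := leqP (size s) i.
  by rewrite h// !scale0r.
by rewrite -cats1 takel_cat.
Qed.

Lemma tree_norm_prefix r s a : (forall i : 'I_k, (size s <= i)%N -> a 0 i = 0) ->
  tree_norm r s a = `|branch_sum s a|.
Proof.
elim: r s => [|r IH] s h //=.
rewrite (_ : (fun m => _) = cst `|branch_sum s a|); first exact: lim_cst.
apply/funext => m /=; rewrite IH ?branch_sum_rcons// => i.
by rewrite size_rcons => /ltnW; exact: h.
Qed.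

Lemma branch_sum_last s m a (j : 'I_k) : j = size s :> nat ->
  branch_sum (rcons s m) (trunc (size s).+1 a) =
  branch_sum s (trunc (size s) a) + a 0 j *: t (rcons s m).
Proof.
move=> js; rewrite -js -[trunc j.+1 a](subrK (trunc j a)) truncS addrC.
rewrite -(@branch_sum_rcons s m (trunc j a)); last first.
  by move=> i; rewrite mxE -js ltnNge => ->.
rewrite /branch_sum; under eq_bigr do rewrite mxE scalerDl.
rewrite big_split /=; congr (_ + _).
rewrite (bigD1 j)//= !mxE eqxx mulr1 take_oversize ?size_rcons ?js// big1 ?addr0//.
by move=> i ij; rewrite !mxE (negPf ij) mulr0 scale0r.
Qed.

(** Inequalities at longer prefixes pass to the limit, except when the truncation ends at [s]. Then
    the truncated sum is the weak limit of the sums with one more node, and weak lower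
    semicontinuity concludes. *)
Lemma tree_norm_monotone r s m a : (size s + r)%N = k -> (size s <= m)%N ->
  tree_norm r s (trunc m a) <= tree_norm r s a.
Proof.
elim: r s m => [|r IH] s m sk sm.
  by rewrite trunc_ge// -sk addn0.
have step m' n : (size s < n)%N ->
    tree_norm r (rcons s m') (trunc n a) <= tree_norm r (rcons s m') a.
  by move=> sn; apply: IH; rewrite size_rcons ?addSnnS.
have [sm'|ms] := ltnP (size s) m.
  apply: (cvg_le (@tree_norm_cvg r s (trunc m a)) (@tree_norm_cvg r s a)).
  by apply: filterE => m'; exact: step.
have {ms sm}-> : m = size s by apply/eqP; rewrite eqn_leq ms.
have jk : (size s < k)%N by rewrite -sk -addSnnS leq_addr.
rewrite tree_norm_prefix; last by move=> i; rewrite mxE ltnNge => ->.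
set v := branch_sum s _.
have -> : v = v + a 0 (Ordinal jk) *: 0 by rewrite scaler0 addr0.
have vt : wcvg U (fun m' => branch_sum (rcons s m') (trunc (size s).+1 a))
    (v + a 0 (Ordinal jk) *: 0).
  move=> f cf; under eq_fun do
    rewrite (branch_sum_last _ _ (j := Ordinal jk))// (clfD _ _ cf) (clfZ _ _ cf).
  rewrite (clfD _ _ cf) (clfZ _ _ cf).
  by apply: cvgD; [exact: cvg_cst|apply: cvgM; [exact: cvg_cst|exact: t_null]].
apply/ler_addgt0Pr => e e0; apply: (wcvg_norm_le vt).
near=> m'.
have : `|tree_norm r (rcons s m') a - tree_norm r.+1 s a| <= e.
  near: m'; under eq_near do rewrite distrC.
  by apply: cvgr_dist_le => //; exact: tree_norm_cvg.
rewrite ler_norml => h.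
have := step m' (size s).+1 (ltnSn _); rewrite tree_norm_prefix; last first.
  by move=> i; rewrite size_rcons mxE => si; rewrite ltnS leqNgt si.
by move: h; lra.
Unshelve. all: by end_near. Qed.

Lemma branch_sum_unit s (j : 'I_k) : branch_sum s (unit_vec R j) = t (take j.+1 s).
Proof.
rewrite /branch_sum (bigD1 j)//= mxE eqxx scale1r big1 ?addr0// => i ij.
by rewrite mxE (negPf ij) scale0r.
Qed.

Lemma tree_norm_unit r s (j : 'I_k) : (size s + r)%N = k -> (size s <= j)%N ->
  tree_norm r s (unit_vec R j) = 1.
Proof.
elim: r s => [|r IH] s sk sj.
  by have := ltn_ord j; rewrite -{2}sk addn0 ltnNge sj.
rewrite /=; apply: (@cvg_lim _ _ _ U) => //.
apply: cvg_near_cst.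
have [sj'|js] := ltnP (size s) j.
  by apply: filterE => m /=; rewrite IH// size_rcons ?addSnnS.
have {sj js}sj : j = size s :> nat by apply/eqP; rewrite eqn_leq js.
apply: filterS (t_norm1 s) => m /= h.
rewrite tree_norm_prefix.
  by rewrite branch_sum_unit take_oversize ?size_rcons ?sj.
by move=> i; rewrite size_rcons mxE -sj ltnNge => ij; case: eqP ij => // ->; rewrite leqnn.
Qed.

Definition root_norm := tree_norm k [::].

(** Each [a 0 i *: unit_vec R i] is a difference of two truncations of [a], both of norm at most
    [root_norm a]. *)
Lemma norm_le_root_norm a : `|a| <= 2 * root_norm a.
Proof.
have [[sp pN] _] := dominated_tree_norm k [::].
apply: row_norm_le => [|i]; first by rewrite mulr_ge0// seminorm_ge0.
have := sp.1 (trunc i.+1 a) (- trunc i a).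
rewrite truncS pN seminormZ// tree_norm_unit// mulr1.
have := @tree_norm_monotone k [::] i.+1 a erefl (leq0n _).
have := @tree_norm_monotone k [::] i a erefl (leq0n _).
rewrite /root_norm; lra.
Qed.

(** By the previous bound the error is at most [d * root_norm a]; the condition on [d] says that
    [(1 + d) / (1 - d) <= 1 + eps]. *)
Lemma near_isometry_equiv (n : 'rV[R]_k -> R) eps d : 0 < eps -> 0 < d ->
  d * (2 + eps) <= eps ->
  (forall a, `|n a - root_norm a| <= d / 2 * `|a|) -> C_equiv (1 + eps) n root_norm.
Proof.
move=> e0 d0 de h.
have d1 : d < 1.
  rewrite ltNge; apply/negP => d1.
  have := ler_wpM2r (ltW (addr_gt0 (ltr0Sn R 1) e0)) d1; lra.
exists (1 + d), (1 - d)^-1; split=> [|||a].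
- by rewrite addr_gt0.
- by rewrite invr_gt0 subr_gt0.
- rewrite ler_pdivrMr ?subr_gt0//; move: de; rewrite !mulrDr mulrDl mulr1 mul1r; lra.
have : `|n a - root_norm a| <= d * root_norm a.
  apply: le_trans (h a) _.
  by rewrite -mulrA ler_pM2l// ler_pdivrMl// norm_le_root_norm.
rewrite ler_norml => /andP[h1 h2]; split.
  by rewrite ler_pdivrMr ?addr_gt0// mulrDr mulr1; lra.
by rewrite ler_pdivlMl ?subr_gt0// mulrBl mul1r; lra.
Qed.

(** The strategy follows a branch [s] along which the remaining limit norm stays close to
    [root_norm], and answers each subspace by one of its unit vectors within [d] of the next
    node. *)
Lemma root_norm_game r s xs eps d : 0 < eps -> 0 < d ->
  4 * k.+1%:R * d * (2 + eps) <= eps ->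
  (size s + r)%N = k -> size xs = size s ->
  (forall i, (i < size s)%N -> `|nth 0 xs i - t (take i.+1 s)| <= d) ->
  (forall a, `|tree_norm r s a - root_norm a| <= (size s)%:R * d * `|a|) ->
  asym_game (X := X) root_norm eps r xs.
Proof.
move=> e0 d0 de; elim: r s xs => [|r IH] s xs sk xss xt rt.
  (* Relative to the sup norm, [k * d] is lost in replacing nodes by answers and [k * d] in the
     successive limits; with [k.+1] for [k] this is half of [4 * k.+1%:R * d]. *)
  rewrite /=; apply: (@near_isometry_equiv _ eps (4 * k.+1%:R * d)) => // [|a].
    by rewrite !mulr_gt0// ltr0n.
  have {sk}sk : size s = k by rewrite -sk addn0.
  have kk : k%:R <= k.+1%:R :> R by rewrite ler_nat.
  have h1 : `| `|\sum_(i < k) a 0 i *: nth 0 xs i| - `|branch_sum s a| |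
      <= k%:R * (d * `|a|).
    apply: le_trans (ler_dist_dist _ _) _; rewrite /branch_sum -sumrB.
    apply: le_trans (ler_norm_sum _ _ _) _.
    have -> : k%:R * (d * `|a|) = \sum_(i < k) d * `|a|.
      by rewrite sumr_const card_ord mulr_natl.
    apply: ler_sum => i _; rewrite -scalerBr normrZ mulrC.
    by apply: ler_pM => //; [apply: xt; rewrite sk|exact: coord_le_norm].
  have h2 := rt a; rewrite sk /= in h2.
  have h3 : k%:R * (d * `|a|) <= k.+1%:R * (d * `|a|).
    by apply: ler_wpM2r kk; rewrite mulr_ge0// ltW.
  move: h1 h2 h3; rewrite !ler_norml.
  rewrite (_ : 4 * k.+1%:R * d / 2 * `|a| = 2 * (k.+1%:R * (d * `|a|))); last by field.
  rewrite -[k%:R * d * `|a|]mulrA; lra.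
move=> Y cY.
have near1 := @wnull_near_sphere _ _ U UU Uoo _ _ _ _ (t_null s)
  (fun m => t_le1 _) (t_norm1 s) cY d0.
have near2 := near_tree_norm r s d0.
have [m [[x [Yx x1 xm]] tm]] := filter_ex (filterI near1 near2).
exists x; split=> //; apply: (IH (rcons s m)).
- by rewrite size_rcons addSnnS.
- by rewrite !size_rcons xss.
- move=> i; rewrite size_rcons ltnS leq_eqVlt nth_rcons xss => /orP[/eqP->|si].
    by rewrite ltnn eqxx take_oversize ?size_rcons.
  by rewrite si -cats1 takel_cat//; exact: xt.
- move=> a; rewrite size_rcons.
  have := tm a; have := rt a; rewrite -natr1 mulrDl mul1r mulrDl !ler_norml; lra.
Qed.

Lemma root_norm_asym_model : in_asym_model X root_norm.
Proof.
have [[[sD sZ] sN] sk] := dominated_tree_norm k [::].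
have sn := (dominated_tree_norm k [::]).1.
split.
- split.
  + by move=> a; exact: seminorm_ge0.
  + move=> a a0; apply/eqP; rewrite -normr_eq0 eq_le normr_ge0 andbT.
    by have := norm_le_root_norm a; rewrite a0 mulr0.
  + by move=> c a; exact: seminormZ.
  + exact: sD.
- split=> [j|m a]; first by apply: tree_norm_unit.
  exact: (@tree_norm_monotone k [::] m a erefl (leq0n _)).
- move=> eps e0; pose d := eps / (4 * k.+1%:R * (2 + eps)).
  have p0 : 0 < 4 * k.+1%:R * (2 + eps) by rewrite !mulr_gt0 ?addr_gt0 ?ltr0n.
  apply: (@root_norm_game k [::] [::] eps d) => //.
  + by rewrite divr_gt0.
  + by rewrite mulrAC /d mulrC divfK// gt_eqF.
  + by move=> a; rewrite subrr normr0 !mul0r.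
Qed.

Lemma generic_branch_norm r s d : 0 < d ->
  generic U r s (fun s' => forall a,
    `| `|branch_sum s' a| - tree_norm r s a| <= r%:R * d * `|a|).
Proof.
move=> d0; elim: r s => [|r IH] s /=; first by move=> a; rewrite subrr normr0 !mul0r.
apply: filterS (near_tree_norm r s d0) => m h; apply: generic_mono (IH _) => w _ h' a.
have := h a; have := h' a; rewrite -natr1 mulrDl mul1r mulrDl !ler_norml /=; lra.
Qed.

(** Both norms are 1 on a unit vector, so [B >= 1] and [A <= c]: [root_norm] is at most [c] times
    the sup norm. The extra 1 is the error of [k] limits taken at precision [1 / k]. *)
Lemma generic_branch_bound c : (0 < k)%N ->
  (forall E : 'rV[R]_k -> R, in_asym_model X E -> C_equiv c E (@linf_norm R k)) ->
  generic U k [::] (fun s => forall a, `|branch_sum s a| <= (c + 1) * `|a|).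
Proof.
move=> k0 hc; have k0' : 0 < k%:R :> R by rewrite ltr0n.
have [A [B [A0 B0 AB h]]] := hc _ root_norm_asym_model.
have u1 : `|unit_vec R (Ordinal k0)| = 1.
  apply/eqP; rewrite eq_le; apply/andP; split.
    by apply: row_norm_le => // i; rewrite mxE; case: eqP => _; rewrite ?normr1 ?normr0.
  by have := coord_le_norm (unit_vec R (Ordinal k0)) (Ordinal k0); rewrite mxE eqxx normr1.
have B1 : 1 <= B.
  have := (h (unit_vec R (Ordinal k0))).2.
  by rewrite linf_normE u1 /root_norm tree_norm_unit// mulr1.
have Ac : A <= c by apply: le_trans AB; rewrite ler_peMr// ltW.
have ki : 0 < k%:R^-1 :> R by rewrite invr_gt0.
apply: generic_mono (generic_branch_norm k [::] ki) => s _; rewrite cat0s => hs a.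
have := hs a; rewrite divff ?gt_eqF// mul1r ler_norml => /andP[_].
have := (h a).1; rewrite linf_normE ler_pdivrMr//.
have := ler_wpM2r (normr_ge0 a) Ac; rewrite -/root_norm mulrDl mul1r [`|a| * A]mulrC; lra.
Qed.
End TreeNorm.

(** * Iterated weak limits *)

Definition parent (s : seq nat) := take (size s).-1 s.

Lemma parent_rcons s m : parent (rcons s m) = s.
Proof. by rewrite /parent size_rcons -cats1 take_size_cat. Qed.

(** * Branch sums of weakly null trees with nodes in the unit ball *)

Section Normalisation.
Context {R : realType} {X : completeNormedModType R}.
Context (U : set_system nat) {UU : UltraFilter U}.
Hypothesis Uoo : \oo `<=` U.

Definition normalise (x : X) : X := `|x|^-1 *: x.

Lemma norm_normalise x : x != 0 -> `|normalise x| = 1.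
Proof.
by move=> x0; rewrite normrZ normfV normr_id mulVf// normr_eq0.
Qed.

Lemma norm_normalise_le1 x : `|normalise x| <= 1.
Proof.
have [->|/norm_normalise->//] := eqVneq x 0.
by rewrite /normalise scaler0 normr0.
Qed.

Lemma normaliseK x : `|x| *: normalise x = x.
Proof.
have [->|x0] := eqVneq x 0; first by rewrite normr0 scale0r.
by rewrite scalerA mulfV ?scale1r// normr_eq0.
Qed.

(** Weak nullity survives division by the norms because these have a nonzero limit. *)
Lemma normalise_null (u : nat -> X) l : wcvg U u 0 -> `|u m| @[m --> U] --> l ->
  l != 0 -> wcvg U (fun m => normalise (u m)) 0.
Proof.
move=> u0 ul l0 f cf; under eq_fun do rewrite (clfZ _ _ cf).
rewrite (clf0 cf) -[0](mulr0 l^-1) -(clf0 cf).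
by apply: cvgM; [exact: cvgV|exact: u0].
Qed.

Lemma near_norm_normalise (u : nat -> X) l : `|u m| @[m --> U] --> l ->
  l != 0 -> \forall m \near U, `|normalise (u m)| = 1.
Proof.
move=> ul l0; have h : \forall m \near U, `|u m| != 0 by exact: cvgr_neq0 ul l0.
by apply: filterS h => m; rewrite normr_eq0; exact: norm_normalise.
Qed.

Variables (k : nat) (t : seq nat -> X) (c : R).
Hypothesis k0 : (0 < k)%N.
Hypothesis t_le1 : forall s, `|t s| <= 1.
Hypothesis t_null : forall s, wcvg U (fun m => t (rcons s m)) 0.
Hypothesis hc : forall E : 'rV[R]_k -> R,
  in_asym_model X E -> C_equiv c E (@linf_norm R k).

Let lam s := lim (`|t (rcons s m)| @[m --> U]).

Let lam_cvg s : `|t (rcons s m)| @[m --> U] --> lam s.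
Proof. by apply: (@ultra_cvg _ _ U UU _ 1) => m; rewrite normr_id. Qed.

(* Nodes whose increments tend to zero in norm are filled with a fixed
   normalized weakly null sequence, taken from any other node. *)
Let filled s0 s : X :=
  if lam (parent s) == 0 then normalise (t (rcons s0 (last 0%N s)))
  else normalise (t s).

(** A generic branch sum is one of the filled tree, with the norms of the nodes as coefficients,
    hence at most [|c| + 1], plus an error of at most [1 / k] per node. If every limit of norms is 0
    there is no filler, but generic sums are then at most 1. *)
Lemma tree_bound :
  generic U k [::] (fun s => `|\sum_(i < k) t (take i.+1 s)| <= `|c| + 2).
Proof.
have ki : 0 < k%:R^-1 :> R by rewrite invr_gt0 ltr0n.
have sum1 : \sum_(i < k) k%:R^-1 = 1 :> R.
  by rewrite sumr_const card_ord -(mulr_natr k%:R^-1 k) mulVf // pnatr_eq0 -lt0n.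
have [[s0 s00]|all0] := pselect (exists s, lam s != 0); last first.
  have near0 s : \forall m \near U, `|t (rcons s m)| <= k%:R^-1.
    apply: cvgr_le (@lam_cvg s) _ _; suff -> : lam s = 0 by [].
    by apply/eqP/negP => /negP ls; apply: all0; exists s.
  have g := @generic_steps U UU k [::] (fun s => `|t s| <= k%:R^-1) near0.
  apply: generic_mono g => w _; rewrite cat0s => h.
  apply: le_trans (ler_norm_sum _ _ _) _; apply: (@le_trans _ _ 1); last first.
    by have := normr_ge0 c; lra.
  by rewrite -sum1; apply: ler_sum => i _; apply: h; exact: ltn_ord.
have filledE s m : filled s0 (rcons s m) =
    if lam s == 0 then normalise (t (rcons s0 m)) else normalise (t (rcons s m)).
  by rewrite /filled parent_rcons last_rcons.
have filled_le1 s : `|filled s0 s| <= 1.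
  by rewrite /filled; case: ifP => _; exact: norm_normalise_le1.
have filled_norm1 s : \forall m \near U, `|filled s0 (rcons s m)| = 1.
  under eq_near do rewrite filledE; case: eqVneq => [_|ls].
    exact: near_norm_normalise (@lam_cvg s0) s00.
  exact: near_norm_normalise (@lam_cvg s) ls.
have filled_null s : wcvg U (fun m => filled s0 (rcons s m)) 0.
  under eq_fun do rewrite filledE; case: eqVneq => [_|ls].
    exact: normalise_null (t_null s0) (@lam_cvg s0) s00.
  exact: normalise_null (t_null s) (@lam_cvg s) ls.
have near0 s : \forall m \near U,
    `|t (rcons s m) - `|t (rcons s m)| *: filled s0 (rcons s m)| <= k%:R^-1.
  under eq_near do rewrite filledE; case: eqVneq => [ls|ls]; last first.
    by apply: filterE => m; rewrite normaliseK subrr normr0 ltW.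
  (* The filler has norm at most 1, so the norm of the node counts twice in the error. *)
  have k2 : lam s < k%:R^-1 / 2 by rewrite ls divr_gt0.
  have tsmall : \forall m \near U, `|t (rcons s m)| <= k%:R^-1 / 2.
    exact: cvgr_le (@lam_cvg s) _ k2.
  apply: filterS tsmall => m tm.
  apply: le_trans (ler_normB _ _) _; rewrite normrZ normr_id.
  have := ler_wpM2l (normr_ge0 (t (rcons s m))) (norm_normalise_le1 (t (rcons s0 m))).
  rewrite mulr1; lra.
have g1 := @generic_branch_bound _ _ U UU Uoo k _ filled_le1 filled_norm1
  filled_null c k0 hc.
have g2 := @generic_steps U UU k [::]
  (fun s => `|t s - `|t s| *: filled s0 s| <= k%:R^-1) near0.
apply: generic_mono (generic_and g1 g2) => w _; rewrite cat0s => -[h1 h2].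
pose a : 'rV[R]_k := \row_i `|t (take i.+1 w)|.
have a1 : `|a| <= 1 by apply: row_norm_le => // i; rewrite mxE normr_id.
have -> : \sum_(i < k) t (take i.+1 w) = branch_sum (filled s0) w a +
    \sum_(i < k) (t (take i.+1 w) - `|t (take i.+1 w)| *: filled s0 (take i.+1 w)).
  rewrite -big_split /=; apply: eq_bigr => i _.
  by rewrite mxE addrC subrK.
have b1 := h1 a.
have b2 : (c + 1) * `|a| <= `|c| + 1.
  apply: le_trans (_ : (`|c| + 1) * `|a| <= _).
    by apply: ler_wpM2r; rewrite ?lerD2r// ler_norm.
  by rewrite ler_piMr// addr_ge0.
have b3 : `|\sum_(i < k)
    (t (take i.+1 w) - `|t (take i.+1 w)| *: filled s0 (take i.+1 w))| <= 1.
  apply: le_trans (ler_norm_sum _ _ _) _.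
  by rewrite -sum1; apply: ler_sum => i _; apply: h2; exact: ltn_ord.
apply: le_trans (ler_normD _ _) _; lra.
Qed.
End Normalisation.

(** * Decomposition of a map on k-subsets along a weakly null tree *)

Section WeakConditioning.
Context {R : realType} {X : completeNormedModType R}.
Context (U : set_system nat) {UU : UltraFilter U}.
Hypothesis Uoo : \oo `<=` U.
Hypothesis reflX : reflexive_space R X.
Variables (k : nat) (f : seq nat -> X) (K L : R).
Hypothesis fK : forall s, `|f s| <= K.
Hypothesis L0 : 0 < L.
Hypothesis fL : forall s s' j, sorted ltn s -> sorted ltn s' ->
  size s = k -> size s' = k ->
  (forall i, i != j -> nth 0%N s i = nth 0%N s' i) -> `|f s - f s'| <= L.

Definition wlim (u : nat -> X) : X := xget 0 [set x | wcvg U u x].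

Lemma wlim_wcvg u : (forall m, `|u m| <= K) -> wcvg U u (wlim u).
Proof.
move=> uK; have [x ux] := reflexive_wcvg reflX uK.
exact: (@xgetI X 0 [set x | wcvg U u x] x ux).
Qed.

(** The analogue of a conditional expectation given the prefix [s], with weak limits along [U] in
    place of averages over the [r] remaining entries. *)
Fixpoint wcond r s : X :=
  if r is r'.+1 then wlim (fun m => wcond r' (rcons s m)) else f s.

Lemma wcond_le r s : `|wcond r s| <= K.
Proof.
elim: r s => [|r IH] s //=.
by apply: (wcvg_norm_le (wlim_wcvg _)) => [m|]; [|apply: filterE => m]; exact: IH.
Qed.

Lemma wcond_wcvg r s : wcvg U (fun m => wcond r (rcons s m)) (wcond r.+1 s).
Proof. by apply: wlim_wcvg => m; exact: wcond_le. Qed.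

(** Both prefixes are extended by the same large entry, so they still differ only at [j]; weak lower
    semicontinuity carries the bound through each limit. *)
Lemma wcond_lipschitz r s s' j : sorted ltn s -> sorted ltn s' ->
  (size s + r)%N = k -> size s = size s' ->
  (forall i, i != j -> nth 0%N s i = nth 0%N s' i) ->
  `|wcond r s - wcond r s'| <= L.
Proof.
elim: r s s' => [|r IH] s s' os os' sk ss' h.
  by apply: (fL (j := j)) => //; rewrite -?ss' -sk addn0.
apply: (wcvg_norm_le (wcvgB (@wcond_wcvg r s) (@wcond_wcvg r s'))).
apply: filterS2 (near_sorted_rcons Uoo os) (near_sorted_rcons Uoo os') => m om om'.
apply: IH => // [||i ij]; rewrite ?size_rcons ?addSnnS ?ss'//.
  by rewrite -ss'.
by rewrite !nth_rcons ss' h.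
Qed.

Definition wnode s := wcond (k - size s) s.

Lemma wnode_wcvg s : (size s < k)%N ->
  wcvg U (fun m => wnode (rcons s m)) (wnode s).
Proof.
move=> sk; rewrite /wnode -(subnSK sk).
under eq_fun do rewrite size_rcons; exact: wcond_wcvg.
Qed.

(** Scaled martingale differences of [wnode]. The value 0 elsewhere makes the norm bound and weak
    nullity hold at all lists, as [tree_bound] demands. *)
Definition wtree s : X :=
  if [&& sorted ltn s, 0 < size s & size s <= k]%N
  then L^-1 *: (wnode s - wnode (parent s)) else 0.

(** The value at the parent is a weak limit of values at siblings of [s], which differ from [s] only
    in the last entry. *)
Lemma wtree_le1 s : `|wtree s| <= 1.
Proof.
rewrite /wtree; case: ifP => [/and3P[]|]; last by rewrite normr0.
case/lastP: s => // s m os _; rewrite size_rcons parent_rcons => sk.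
rewrite normrZ gtr0_norm ?invr_gt0// ler_pdivrMl// mulr1.
have os' : sorted ltn s.
  by apply: subseq_sorted os; [exact: ltn_trans|exact: subseq_rcons].
apply: (wcvg_norm_le (wcvgB (@wcvg_cst _ _ U _ _ (wnode (rcons s m))) (wnode_wcvg sk))).
apply: filterS (near_sorted_rcons Uoo os') => m' om'.
rewrite /wnode !size_rcons; apply: (@wcond_lipschitz _ _ _ (size s)) => //.
- by rewrite size_rcons subnKC.
- by rewrite !size_rcons.
- by move=> i ij; rewrite !nth_rcons (negPf ij).
Qed.

Lemma wtree_null s : wcvg U (fun m => wtree (rcons s m)) 0.
Proof.
have [/andP[os sk]|h] := boolP (sorted ltn s && (size s < k)%N); last first.
  apply: (near_wcvg (u := fun=> 0)); last exact: wcvg_cst.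
  apply: filterE => m.
  rewrite /wtree size_rcons /=; case: ifP => // /andP[om sk]; exfalso.
  case/negP: h; rewrite sk andbT.
  by apply: subseq_sorted om; [exact: ltn_trans|exact: subseq_rcons].
apply: (near_wcvg (u := fun m => L^-1 *: (wnode (rcons s m) - wnode s))).
  apply: filterS (near_sorted_rcons Uoo os) => m om.
  by rewrite /wtree om size_rcons sk parent_rcons.
move=> g cg; under eq_fun do rewrite (clfZ _ _ cg) (clfB _ _ cg).
rewrite (clf0 cg) -[0](mulr0 L^-1) -(subrr (g (wnode s))).
apply: cvgM; first exact: cvg_cst.
by apply: cvgB; [exact: (wnode_wcvg sk)|exact: cvg_cst].
Qed.

Lemma wtree_telescope s : sorted ltn s -> size s = k ->
  \sum_(i < k) wtree (take i.+1 s) = L^-1 *: (f s - wnode [::]).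
Proof.
move=> os sk.
have -> : f s = wnode (take k s) by rewrite -sk take_size /wnode sk subnn.
rewrite -[in RHS](take0 s) -(telescope_sumr (fun i => wnode (take i s)))//.
rewrite big_mkord scaler_sumr; apply: eq_bigr => i _.
have ik : size (take i.+1 s) = i.+1 by rewrite size_takel// sk.
rewrite /wtree ik ltn_ord take_sorted//= /parent ik /=.
by rewrite -take_min (minn_idPl (leqnSn i)).
Qed.

Variable c : R.
Hypothesis k0 : (0 < k)%N.
Hypothesis hc : forall E : 'rV[R]_k -> R,
  in_asym_model X E -> C_equiv c E (@linf_norm R k).

(** Telescoping along a branch turns the bound on branch sums into concentration around a single
    vector, with a factor [|c| + 2] in which [k] does not enter. *)
Lemma generic_concentration :
  generic U k [::] (fun s => `|f s - wnode [::]| <= L * (`|c| + 2)).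
Proof.
have g1 := @tree_bound _ _ U UU Uoo k wtree c k0 wtree_le1 wtree_null hc.
have g2 := @generic_sorted U UU k [::] Uoo isT.
apply: generic_mono (generic_and g1 g2) => w wk; rewrite cat0s => -[h os].
move: h; rewrite wtree_telescope// normrZ gtr0_norm ?invr_gt0// ler_pdivrMl//.
Qed.
End WeakConditioning.

(** * Distortion *)

Section HammingType.
Context {R : realType} {Y : normedModType R} (e : nat -> Y).
Hypothesis e1 : normalized_seq e.

(** A crude bound that makes embeddings bounded, so that the weak limits exist. *)
Lemma dk_le k m n : dk e k m n <= k%:R.
Proof.
apply: le_trans (ler_norm_sum _ _ _) _.
under eq_bigr do rewrite e1.
rewrite sumr_const ler_nat; apply: leq_trans (max_card _) _.
by rewrite card_ord.
Qed.

Lemma dk_single_le1 k m n j :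
  (forall i, i != j -> nth 0%N m i = nth 0%N n i) -> dk e k m n <= 1.
Proof.
move=> h; rewrite /dk; have [jk|kj] := ltnP j k; last first.
  rewrite big_pred0 ?normr0// => i; rewrite h ?eqxx//.
  by apply: contraTneq kj => <-; rewrite -ltnNge.
have hj (i : 'I_k) : i != Ordinal jk -> nth 0%N m i = nth 0%N n i by exact: h.
have [mn|mn] := eqVneq (nth 0%N m j) (nth 0%N n j).
  rewrite big_pred0 ?normr0// => i; have [->/=|/hj->] := eqVneq i (Ordinal jk).
    by rewrite mn eqxx.
  by rewrite eqxx.
rewrite (big_pred1 (Ordinal jk)) ?e1// => i /=.
by have [->/=|/hj->] := eqVneq i (Ordinal jk); rewrite ?eqxx.
Qed.
End HammingType.

(** As [dk] depends only on the positions where two lists differ, [m] and [n] can be traded for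
    generic k-subsets with the same pattern. Their images are near one vector, and the lower
    estimate on [f] bounds [dk]. *)
Lemma embedding_distortion (R : realType) (X : completeNormedModType R)
    (Y : normedModType R) (e : nat -> Y) (k : nat) (c s D : R) (f : seq nat -> X)
    (m n : seq nat) :
  reflexive_space R X -> normalized_seq e -> (0 < k)%N ->
  (forall E : 'rV[R]_k -> R, in_asym_model X E -> C_equiv c E (@linf_norm R k)) ->
  0 < s -> 0 < D ->
  (forall x y, ksubsets k setT x -> ksubsets k setT y ->
    s * dk e k x y <= `|f x - f y| /\ `|f x - f y| <= s * D * dk e k x y) ->
  dk e k m n <= 2 * (`|c| + 2) * D.
Proof.
move=> reflX e1 k0 hc s0 D0 fD.
have [U [UU Uoo]] := @ultraFilterLemma _ (\oo : set_system nat) _.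
(* [f] is controlled on k-subsets only, whereas the iterated limits require a bound at every
   list. *)
pose g w := if sorted ltn w && (size w == k) then f w else 0.
have gE w : sorted ltn w -> size w = k -> g w = f w.
  by rewrite /g => -> ->; rewrite eqxx.
have ks w : sorted ltn w -> size w = k -> ksubsets k setT w by [].
have L0 : 0 < s * D by rewrite mulr_gt0.
have os0 : sorted ltn (iota 0 k) by exact: iota_ltn_sorted.
have gK w : `|g w| <= `|f (iota 0 k)| + s * D * k%:R.
  rewrite /g; case: ifP => [/andP[ow /eqP wk]|_]; last first.
    by rewrite normr0 addr_ge0// mulr_ge0// ltW.
  have := (fD _ _ (ks w ow wk) (ks _ os0 (size_iota 0 k))).2.
  have := ler_wpM2l (ltW L0) (dk_le e1 k w (iota 0 k)).
  have := ler_normD (f w - f (iota 0 k)) (f (iota 0 k)); rewrite subrK; lra.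
have gL w w' j : sorted ltn w -> sorted ltn w' -> size w = k -> size w' = k ->
    (forall i, i != j -> nth 0%N w i = nth 0%N w' i) -> `|g w - g w'| <= s * D.
  move=> ow ow' wk wk' h; rewrite !gE//.
  apply: le_trans (fD _ _ (ks w ow wk) (ks w' ow' wk')).2 _.
  by rewrite ger_pMr// (dk_single_le1 e1 _ h).
have conc := @generic_concentration _ _ U UU Uoo reflX k g _ _ gK L0 gL c k0 hc.
have os := @generic_sorted U UU k [::] Uoo isT.
have good := @generic_and U UU k [::] _ _ conc os.
have [w [w' [wk wk' [hw ow] [hw' ow'] diff]]] :=
  @generic_pair U UU k [::] [::] _ _ (fun i => nth 0%N m i != nth 0%N n i) Uoo good good.
move: hw ow hw' ow'; rewrite !cat0s => hw ow hw' ow'.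
have -> : dk e k m n = dk e k w w'.
  by congr `|_|; apply: eq_bigl => i; rewrite diff.
have [low _] := fD _ _ (ks _ ow wk) (ks _ ow' wk').
have := ler_normB (g w - wnode U k g [::]) (g w' - wnode U k g [::]).
rewrite opprB addrA subrK (gE w ow wk) (gE w' ow' wk') => tri.
rewrite (gE w ow wk) in hw; rewrite (gE w' ow' wk') in hw'.
rewrite -(ler_pM2l s0); move: hw hw' low tri; lra.
Qed.

Theorem theorem3p4 (R : realType) (X : completeNormedModType R) :
  separable R X -> reflexive_space R X -> asymptotic_c0 R X ->
  forall (Y : completeNormedModType R) (e : nat -> Y),
    normalized_seq e -> suppression_unconditional1 e -> basic_sequence e ->
    (fun k => ereal_inf [set diam_k e k M | M in [set M : set nat | infinite_set M]])
      @ \oo --> +oo%E ->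
    ereal_sup [set cX X (ksubsets k setT) (dk e k) | k in [set: nat]] = +oo%E.
Proof.
move=> _ reflX [c hc] Y e e1 _ _ diam_oo.
apply/eqyP => A A0.
have c2 : 0 < 2 * (`|c| + 2) by rewrite mulr_gt0// ltr_wpDl.
(* The extra 1 yields a strict inequality, hence an actual pair [m], [n] beyond the bound. *)
move/cvgeyPge : diam_oo => /(_ (2 * (`|c| + 2) * A + 1)) large.
have [k [hk k0]] := filter_ex (filterI large (nbhs_infty_gt 0)).
apply: (@le_trans _ _ (cX X (ksubsets k setT) (dk e k))); last first.
  by apply: ereal_sup_ubound; exists k.
apply: le_ereal_inf_tmp => _ [D [D1 [s [s0 [f fD]]]] <-].
have D0 : 0 < D by exact: lt_le_trans D1.
(* The infimum over infinite sets bounds from below the diameter over all of [nat]. *)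
have kd : ((2 * (`|c| + 2) * A)%:E < diam_k e k setT)%E.
  apply: (@lt_le_trans _ _ (2 * (`|c| + 2) * A + 1)%:E).
    by rewrite lte_fin ltrDl.
  apply: le_trans hk _; apply: ereal_inf_lbound; exists setT => //.
  exact: infinite_nat.
have [_ [m [n [_ _ ->]]]] := ereal_sup_gt kd.
rewrite lte_fin lee_fin => mn.
have := embedding_distortion m n reflX e1 k0 (hc k) s0 D0 fD.
by move=> /(lt_le_trans mn); rewrite ltr_pM2l// => /ltW.
Qed.
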